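(* Let $L>0$ and $(x_0,y_0)\in(0,L)^2$. For $\epsilon>0$ let $N=\lceil L/\epsilon\rceil$, $i_0=\lfloor Nx_0/L\rfloor$, $j_0=\lfloor Ny_0/L\rfloor$, let $u_\epsilon=(i_0\epsilon,j_0\epsilon)$, and let $\mathfrak d_{\epsilon,u_\epsilon}(i,j)$ be the stationary destination distribution, conditioned on the agent being at $u_\epsilon$, of the Manhattan Markov Trace Model $(\mathcal T_\epsilon,\Psi_\epsilon)$ at destination grid point $(i\epsilon,j\epsilon)$. Define $$\phi^{south}=\lim_{\epsilon\to0^+}\sum_{j=0}^{j_0}\mathfrak d_{\epsilon,u_\epsilon}(i_0,j),\quad \phi^{north}=\lim_{\epsilon\to0^+}\sum_{j=j_0}^{N-1}\mathfrak d_{\epsilon,u_\epsilon}(i_0,j),$$ $$\phi^{west}=\lim_{\epsilon\to0^+}\sum_{i=0}^{i_0}\mathfrak d_{\epsilon,u_\epsilon}(i,j_0),\quad \phi^{east}=\lim_{\epsilon\to0^+}\sum_{i=i_0}^{N-1}\mathfrak d_{\epsilon,u_\epsilon}(i,j_0).$$ Then $$\phi^{south}=\phi^{north}=\frac{y_0(L-y_0)}{4L(x_0+y_0)-4(x_0^2+y_0^2)},\qquad \phi^{west}=\phi^{east}=\frac{x_0(L-x_0)}{4L(x_0+y_0)-4(x_0^2+y_0^2)},$$ and hence $\phi^{south}+\phi^{north}+\phi^{west}+\phi^{east}=\frac12$.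
   Context: Manhattan Markov Trace Model: $V_\epsilon=\{(i\epsilon,j\epsilon): i,j\in\{0,\dots,N-1\}\}$ with $N=\lceil L/\epsilon\rceil$ (assume $\epsilon$ small enough that $N\ge2$); two points are adjacent when their Euclidean distance is $\epsilon$. For distinct $v=(a,b)$ and $u=(a',b')$ in $V_\epsilon$ the feasible paths from $v$ to $u$ are: the grid path consisting of the horizontal segment from $(a,b)$ to $(a',b)$ followed by the vertical segment to $(a',b')$, and the grid path consisting of the vertical segment from $(a,b)$ to $(a,b')$ followed by the horizontal segment to $(a',b')$ (these coincide if $a=a'$ or $b=b'$). $\mathcal T_\epsilon$ is the set of point sequences $T=(T(0),\dots,T(|T|-1))$ (successive adjacent grid points, $T_{start}=T(0)$, $T_{end}=T(|T|-1)$) of all feasible paths between distinct points of $V_\epsilon$; $\Psi_\epsilon$ assigns to each $u\in V_\epsilon$ the uniform distribution $\psi_u$ over the traces of $\mathcal T_\epsilon$ starting at $u$. The model is the Markov chain on $S(\mathcal T_\epsilon)=\{\langle T,i\rangle:T\in\mathcal T_\epsilon,1\le i\le|T|-1\}$ with $\Pr(\langle T,i\rangle\to\langle T,i+1\rangle)=1$ for $1\le i<|T|-1$, $\Pr(\langle T,|T|-1\rangle\to\langle T',1\rangle)=\psi_{T_{end}}(T')$ for every $T'$ with $T'_{start}=T_{end}$, all other transition probabilities $0$. It has a unique stationary distribution $\pi$ (the uniform one). The stationary spatial distribution is $\mathfrak s_\epsilon(u)=\sum_{\langle T,i\rangle\in S(\mathcal T_\epsilon),\,T(i)=u}\pi(\langle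 T,i\rangle)$ and the stationary destination distribution is $\mathfrak d_{\epsilon,u}(v)=\frac1{\mathfrak s_\epsilon(u)}\sum_{\langle T,i\rangle\in S(\mathcal T_\epsilon),\,T(i)=u,\,T_{end}=v}\pi(\langle T,i\rangle)$, written $\mathfrak d_{\epsilon,u}(i,j)$ for $v=(i\epsilon,j\epsilon)$. *)

(* Defs.v *)
From mathcomp Require Import all_boot all_order all_algebra.
From mathcomp Require Import all_classical all_reals all_analysis.
Set Implicit Arguments.
Unset Strict Implicit.
Unset Printing Implicit Defensive.
Import Order.TTheory GRing.Theory Num.Theory.
Import numFieldNormedType.Exports.
Local Open Scope ring_scope.

(* A grid point (i eps, j eps) is represented by its index pair (i, j), so two
   points are adjacent when their indices differ by 1 in exactly one
   coordinate.  The chain then depends on L and eps only through the number N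
   of points per side. *)
Definition point : Type := (nat * nat)%type.

Definition grid (N : nat) : seq point :=
  [seq (i, j) | i <- iota 0 N, j <- iota 0 N].

(* The integers from a to b inclusive, in the order of travel (decreasing when
   b < a). *)
Definition walk (a b : nat) : seq nat :=
  if (a <= b)%N then iota a (b - a).+1 else rev (iota b (a - b).+1).

(* [behead] keeps the corner from being listed twice. *)
Definition hv_path (v u : point) : seq point :=
  [seq (x, v.2) | x <- walk v.1 u.1] ++
  [seq (u.1, y) | y <- behead (walk v.2 u.2)].

Definition vh_path (v u : point) : seq point :=
  [seq (v.1, y) | y <- walk v.2 u.2] ++
  [seq (x, u.2) | x <- behead (walk v.1 u.1)].

Definition journeys (N : nat) : seq (point * point) :=
  [seq p <- [seq (v, u) | v <- grid N, u <- grid N] | p.1 != p.2].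

(* [undup]: the traces form a set, so the two paths of a journey count once
   when they coincide. *)
Definition traces (N : nat) : seq (seq point) :=
  undup ([seq hv_path p.1 p.2 | p <- journeys N] ++
         [seq vh_path p.1 p.2 | p <- journeys N]).

Definition tr_at (T : seq point) (i : nat) : point := nth (0%N, 0%N) T i.
Definition tr_start (T : seq point) : point := tr_at T 0.
Definition tr_end (T : seq point) : point := tr_at T (size T).-1.

Definition traces_from (N : nat) (u : point) : seq (seq point) :=
  [seq T <- traces N | tr_start T == u].

Definition psi (R : realType) (N : nat) (u : point) (T : seq point) : R :=
  if T \in traces_from N u then (size (traces_from N u))%:R^-1 else 0.

(* The pairs <T, i> with 1 <= i <= |T| - 1; position 0 is not a state. *)
Definition states (N : nat) : seq (seq point * nat) :=
  [seq (T, i) | T <- traces N, i <- iota 1 (size T).-1].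

Definition state (N : nat) : finType := seq_sub (states N).

Definition st_trace (N : nat) (s : state N) : seq point := (val s).1.
Definition st_idx (N : nat) (s : state N) : nat := (val s).2.
Definition st_pos (N : nat) (s : state N) : point := tr_at (st_trace s) (st_idx s).
Definition st_dest (N : nat) (s : state N) : point := tr_end (st_trace s).

Definition trans (R : realType) (N : nat) (s t : state N) : R :=
  if (st_idx s < (size (st_trace s)).-1)%N then
    ((st_trace t == st_trace s) && (st_idx t == (st_idx s).+1))%:R
  else if st_idx t == 1%N then psi R N (st_dest s) (st_trace t)
  else 0.

Definition stationary (R : realType) (N : nat) (p : {ffun state N -> R}) : Prop :=
  [/\ forall s, 0 <= p s,
      \sum_s p s = 1 &
      forall t, \sum_s p s * trans R s t = p t].

(* The stationary distribution of the chain, which is unique for N >= 2; for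
   N < 2 there are no traces and the value is irrelevant. *)
Definition stat_dist (R : realType) (N : nat) : {ffun state N -> R} :=
  xget [ffun=> 0] [set p | stationary p]%classic.

Definition spatial_dist (R : realType) (N : nat) (u : point) : R :=
  \sum_(s : state N | st_pos s == u) stat_dist R N s.

Definition dest_dist (R : realType) (N : nat) (u v : point) : R :=
  (spatial_dist R N u)^-1 *
  \sum_(s : state N | (st_pos s == u) && (st_dest s == v)) stat_dist R N s.

(* The arguments of [ceil] and [floor] are nonnegative in all uses, so
   absolute value is just the conversion from int to nat. *)
Definition grid_size (R : realType) (L eps : R) : nat := `|Num.ceil (L / eps)|%N.

(* The grid index, along one axis, of the coordinate x. *)
Definition grid_idx (R : realType) (L eps x : R) : nat :=
  `|Num.floor ((grid_size L eps)%:R * x / L)|%N.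

(* Main.v *)
Require Import Defs.
From mathcomp Require Import all_boot all_order all_algebra zify ring lra.
From mathcomp Require Import all_classical all_reals all_analysis.
Set Implicit Arguments.
Unset Strict Implicit.
Unset Printing Implicit Defensive.
Import Order.TTheory GRing.Theory Num.Theory.
Import numFieldNormedType.Exports.

(* As many traces end at a grid point as start there, so the uniform distribution
   is stationary; the maximum principle makes it the only stationary one.  Hence
   destination probabilities are quotients of numbers of states.  With
   M = N - 1, the number of states at (i0, j0) whose destination (i0, j) lies on
   the vertical axis is M + N (M - j0) for j < j0, M + N j0 for j > j0 and 2 N M
   for j = j0; the total number of states at (i0, j0) is
   (2 N - 1) (2 i0 (M - i0) + 2 j0 (M - j0) + 2 M).  Dividing both by N ^ 3 and
   letting N grow gives the limits. *)

(** * Walks and traces *)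

(** The start [a] is left out and the end [b] kept, since a state [<T, i>] has [i >= 1]; a walk that
    does not move visits nothing. *)
Definition visits (a b x : nat) : bool := (a < x <= b) || (b <= x < a).

Lemma walkE a b : walk a b = a :: behead (walk a b).
Proof.
rewrite /walk; case: leqP => // ltba.
by rewrite -addn1 iotaD rev_cat /= subnKC // ltnW.
Qed.

Lemma behead_walkE a b :
  behead (walk a b) = if a <= b then iota a.+1 (b - a) else rev (iota b (a - b)).
Proof.
rewrite /walk; case: leqP => // ltba.
by rewrite -addn1 iotaD rev_cat.
Qed.

Lemma walknn a : walk a a = [:: a].
Proof. by rewrite /walk leqnn subnn. Qed.

Lemma last_walk a b : last a (behead (walk a b)) = b.
Proof.
have -> : last a (behead (walk a b)) = last 0 (walk a b) by rewrite walkE.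
rewrite /walk; case: leqP => [leab|ltba].
  by rewrite -addn1 iotaD cats1 last_rcons subnKC.
by rewrite /= rev_cons last_rcons.
Qed.

Lemma count_behead_walk a b x : count_mem x (behead (walk a b)) = visits a b x.
Proof.
rewrite behead_walkE; case: leqP => ab.
  rewrite count_uniq_mem ?iota_uniq // mem_iota /visits; congr nat_of_bool; lia.
rewrite count_uniq_mem ?rev_uniq ?iota_uniq // mem_rev mem_iota /visits.
congr nat_of_bool; lia.
Qed.

Lemma hv_pathE v u :
  hv_path v u = v :: [seq (x, v.2) | x <- behead (walk v.1 u.1)] ++
                     [seq (u.1, y) | y <- behead (walk v.2 u.2)].
Proof. by rewrite /hv_path walkE /=; case: v. Qed.

Lemma vh_pathE v u :
  vh_path v u = v :: [seq (v.1, y) | y <- behead (walk v.2 u.2)] ++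
                     [seq (x, u.2) | x <- behead (walk v.1 u.1)].
Proof. by rewrite /vh_path walkE /=; case: v. Qed.

Lemma hv_path_start v u : tr_start (hv_path v u) = v.
Proof. by rewrite hv_pathE. Qed.

Lemma vh_path_start v u : tr_start (vh_path v u) = v.
Proof. by rewrite vh_pathE. Qed.

Lemma hv_path_end v u : tr_end (hv_path v u) = u.
Proof.
rewrite /tr_end /tr_at nth_last hv_pathE /= last_cat.
case: v u => [a b] [c d] /=.
rewrite -[(a, b)]/((fun x => (x, b)) a) last_map last_walk.
by rewrite -[(c, b)]/((fun y => (c, y)) b) last_map last_walk.
Qed.

Lemma vh_path_end v u : tr_end (vh_path v u) = u.
Proof.
rewrite /tr_end /tr_at nth_last vh_pathE /= last_cat.
case: v u => [a b] [c d] /=.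
rewrite -[(a, b)]/((fun y => (a, y)) b) last_map last_walk.
by rewrite -[(a, d)]/((fun x => (x, d)) a) last_map last_walk.
Qed.

Lemma count_row (x : Defs.point) b (s : seq nat) :
  count_mem x [seq (a, b) | a <- s] = (x.2 == b) * count_mem x.1 s.
Proof.
rewrite count_map; case: x => c d /=; have [->|ne] := eqVneq d b.
  by rewrite mul1n; apply: eq_count => a; rewrite /= xpair_eqE eqxx andbT.
rewrite mul0n -(count_pred0 s); apply: eq_count => a.
by rewrite /= xpair_eqE [b == d]eq_sym (negbTE ne) andbF.
Qed.

Lemma count_column (x : Defs.point) a (s : seq nat) :
  count_mem x [seq (a, b) | b <- s] = (x.1 == a) * count_mem x.2 s.
Proof.
rewrite count_map; case: x => c d /=; have [->|ne] := eqVneq c a.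
  by rewrite mul1n; apply: eq_count => b; rewrite /= xpair_eqE eqxx.
rewrite mul0n -(count_pred0 s); apply: eq_count => b.
by rewrite /= xpair_eqE [a == c]eq_sym (negbTE ne).
Qed.

Lemma count_behead_hv_path x v u :
  count_mem x (behead (hv_path v u)) =
  (x.2 == v.2) * visits v.1 u.1 x.1 + (x.1 == u.1) * visits v.2 u.2 x.2.
Proof.
by rewrite hv_pathE count_cat count_row count_column !count_behead_walk.
Qed.

Lemma count_behead_vh_path x v u :
  count_mem x (behead (vh_path v u)) =
  (x.1 == v.1) * visits v.2 u.2 x.2 + (x.2 == u.2) * visits v.1 u.1 x.1.
Proof.
by rewrite vh_pathE count_cat count_row count_column !count_behead_walk.
Qed.

(** These are the journeys with two different paths. *)
Definition off_axis (p : Defs.point * Defs.point) : bool :=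
  (p.1.1 != p.2.1) && (p.1.2 != p.2.2).

Lemma vh_hv_path v u : ~~ off_axis (v, u) -> vh_path v u = hv_path v u.
Proof.
rewrite negb_and !negbK /= vh_pathE hv_pathE.
by case/orP => /eqP ->; rewrite walknn //= cats0.
Qed.

Lemma hv_path_neq_vh_path v u : off_axis (v, u) -> hv_path v u != vh_path v u.
Proof.
(* The corner [(u.1, v.2)] of the horizontal-first path does not lie on the vertical-first one. *)
case/andP => /= ne1 ne2; apply/eqP => /(congr1 behead)/(congr1 (count_mem (u.1, v.2))).
rewrite count_behead_hv_path count_behead_vh_path /= !eqxx (negbTE ne2).
rewrite eq_sym (negbTE ne1) /visits leqnn; move: ne1; lia.
Qed.

Lemma path_inj (f : Defs.point -> Defs.point -> seq Defs.point) :
    (forall v u, tr_start (f v u) = v) -> (forall v u, tr_end (f v u) = u) ->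
  injective (fun p => f p.1 p.2).
Proof.
move=> fs fe [v u] [v' u'] /= e; congr (_, _).
  by rewrite -(fs v u) e fs.
by rewrite -(fe v u) e fe.
Qed.

Lemma grid_uniq N : uniq (grid N).
Proof. by apply: allpairs_uniq; rewrite ?iota_uniq // => -[? ?] [? ?]. Qed.

Lemma journeys_uniq N : uniq (journeys N).
Proof.
by rewrite filter_uniq // allpairs_uniq ?grid_uniq // => -[? ?] [? ?].
Qed.

Lemma mem_grid N (u : Defs.point) : (u \in grid N) = (u.1 < N) && (u.2 < N).
Proof.
case: u => i j /=; apply/allpairsP/idP => [[[a b] [/=]]|/andP[iN jN]].
  by rewrite !mem_iota !add0n => /= ? ? [-> ->]; apply/andP.
by exists (i, j); rewrite /= !mem_iota !add0n.
Qed.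

Lemma mem_journeys N v u :
  ((v, u) \in journeys N) = [&& v != u, v \in grid N & u \in grid N].
Proof.
rewrite mem_filter /=; congr (_ && _).
apply/allpairsP/andP => [[[a b] [/= ? ? [-> ->]]]//|[vN uN]].
by exists (v, u).
Qed.

(** A path determines its endpoints, so only the two paths of one journey can coincide, and they do
    exactly when it is not [off_axis]. What [undup] removes is therefore the vertical-first path of
    each remaining journey. *)
Lemma perm_traces N :
  perm_eq (traces N)
    ([seq hv_path p.1 p.2 | p <- journeys N] ++
     [seq vh_path p.1 p.2 | p <- journeys N & off_axis p]).
Proof.
have hv_inj := path_inj hv_path_start hv_path_end.
have vh_inj := path_inj vh_path_start vh_path_end.
apply: uniq_perm; first exact: undup_uniq.
  rewrite cat_uniq !map_inj_uniq // journeys_uniq filter_uniq ?journeys_uniq //.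
  rewrite andbT /=.
  apply/hasPn => T /mapP[[v u] /=]; rewrite mem_filter => /andP[off _] ->.
  apply/mapP => -[[v' u'] _ /= e]; have := hv_path_neq_vh_path off.
  have ev : v = v' by rewrite -(hv_path_start v' u') -e vh_path_start.
  have eu : u = u' by rewrite -(hv_path_end v' u') -e vh_path_end.
  by rewrite {1}ev {1}eu e eqxx.
move=> T; rewrite mem_undup !mem_cat; apply/orP/orP.
  case=> [->|]; first by left.
  case/mapP => -[v u] vu /= ->; case: (boolP (off_axis (v, u))) => off.
    by right; apply/mapP; exists (v, u); rewrite // mem_filter off.
  by left; apply/mapP; exists (v, u); rewrite // vh_hv_path.
case=> [->|/mapP[p]]; first by left.
by rewrite mem_filter => /andP[_ pJ] ->; right; apply/mapP; exists p.
Qed.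

Lemma big_traces (R : Type) (idx : R) (op : Monoid.com_law idx) N
    (F : seq Defs.point -> R) :
  \big[op/idx]_(T <- traces N) F T =
  \big[op/idx]_(p <- journeys N)
    op (F (hv_path p.1 p.2)) (if off_axis p then F (vh_path p.1 p.2) else idx).
Proof.
rewrite (perm_big _ (perm_traces N)) big_cat !big_map big_filter big_split /=.
by rewrite -big_mkcond.
Qed.

(** * Stationary distribution *)

Lemma traces_journey N T : T \in traces N -> (tr_start T, tr_end T) \in journeys N.
Proof.
rewrite (perm_mem (perm_traces N)) mem_cat => /orP[] /mapP[[v u]].
  by move=> vu ->; rewrite hv_path_start hv_path_end.
by rewrite mem_filter => /andP[_ vu] ->; rewrite vh_path_start vh_path_end.
Qed.

Lemma hv_path_traces N v u : (v, u) \in journeys N -> hv_path v u \in traces N.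
Proof.
move=> vu; rewrite (perm_mem (perm_traces N)) mem_cat; apply/orP; left.
by apply/mapP; exists (v, u).
Qed.

Lemma size_trace N T : T \in traces N -> 1 < size T.
Proof.
move=> /traces_journey; rewrite mem_journeys => /andP[+ _]; apply: contraR.
by case: T => [|x []].
Qed.

Lemma states_uniq N : uniq (states N).
Proof.
apply: allpairs_uniq_dep; first exact: undup_uniq.
  by move=> T _; exact: iota_uniq.
by move=> [T i] [T' i'] _ _ [-> ->].
Qed.

Lemma mem_states N T i : ((T, i) \in states N) = (T \in traces N) && (0 < i < size T).
Proof.
apply/allpairsPdep/andP => [[T1 [i1 [T1N]]]|[TN iT]].
  by rewrite mem_iota add1n (ltn_predK (size_trace T1N)) => iT [-> ->].
by exists T, i; rewrite mem_iota add1n (ltn_predK (size_trace TN)).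
Qed.

Local Open Scope ring_scope.

(** Sums over the finite type of states become sums over a list, which then split into a sum over
    traces and one over indices. *)
Lemma big_state (R : nmodType) N (P : pred (seq Defs.point * nat))
    (F : seq Defs.point * nat -> R) :
  \sum_(s : state N | P (val s)) F (val s) = \sum_(x <- states N | P x) F x.
Proof.
rewrite -[RHS](congr1 (fun r => \sum_(x <- r | P x) F x)
                   (val_seq_sub_enum (states_uniq N))).
rewrite big_map; apply: perm_big.
apply: uniq_perm; rewrite ?index_enum_uniq ?undup_uniq // => x.
by rewrite mem_index_enum mem_seq_sub_enum.
Qed.

Lemma psiE (R : realType) N u T : T \in traces N ->
  psi R N u T = if tr_start T == u then (size (traces_from N u))%:R^-1 else 0.
Proof. by move=> TN; rewrite /psi mem_filter TN andbT. Qed.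

(** A state [<T, 1>] is entered only from the last states of the traces that end where [T] starts,
    each with the same probability. *)
Lemma sum_trans_first (R : realType) N (P : seq Defs.point * nat -> R) (t : state N) :
    st_idx t = 1%N ->
  \sum_(s : state N) P (val s) * trans R s t =
  (\sum_(T <- traces N | tr_end T == tr_start (st_trace t)) P (T, (size T).-1)) /
  (size (traces_from N (tr_start (st_trace t))))%:R.
Proof.
case: t => -[T i] TiN; rewrite /st_idx /st_trace /= => i1; subst i.
have [TN _] := andP (etrans (esym (mem_states N T 1)) TiN).
pose G (x : seq Defs.point * nat) := P x *
  if (x.2 < (size x.1).-1)%N then ((T == x.1) && (1%N == x.2.+1))%:R
  else psi R N (tr_end x.1) T.
rewrite (eq_bigr (fun s => G (val s))); last by move=> [[T1 k] ?].
rewrite (@big_state _ _ xpredT G) big_allpairs_dep mulr_suml [RHS]big_mkcond /=.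
apply: eq_big_seq => T1 T1N; have T1_size := size_trace T1N.
have m_in : (size T1).-1 \in iota 1 (size T1).-1.
  by rewrite mem_iota add1n ltnSn andbT -ltnS (ltn_predK T1_size).
rewrite (bigD1_seq _ m_in) ?iota_uniq //= big_seq_cond big1 ?addr0.
  rewrite /G /= ltnn psiE // eq_sym.
  by case: eqVneq => [->|]; rewrite ?mulr0.
(* Before its last index a trace moves to [k.+1], which is not 1 because [k >= 1]. *)
move=> k; rewrite mem_iota add1n ltnS /G /= => /andP[/andP[k0 km] kNm].
by rewrite ltn_neqAle kNm km; case: k k0 {km kNm} => // k _; rewrite andbF mulr0.
Qed.

(** Past index 1, the only predecessor of a state is the preceding state of the same trace. *)
Lemma sum_trans_next (R : realType) N (P : seq Defs.point * nat -> R) (t : state N) k :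
    st_idx t = k.+2 ->
  \sum_(s : state N) P (val s) * trans R s t = P (st_trace t, k.+1).
Proof.
case: t => -[T i] TiN; rewrite /st_idx /st_trace /= => i1; subst i.
have [TN kT] := andP (etrans (esym (mem_states N T k.+2)) TiN).
pose G (x : seq Defs.point * nat) := P x *
  if (x.2 < (size x.1).-1)%N then ((T == x.1) && (k.+2 == x.2.+1))%:R else 0.
rewrite (eq_bigr (fun s => G (val s))); last by move=> [[T1 j] ?].
have TkN : (T, k.+1) \in states N by rewrite mem_states TN; lia.
rewrite (@big_state _ _ xpredT G) (bigD1_seq _ TkN) ?states_uniq //= big1 ?addr0.
  by rewrite /G /= -ltnS (ltn_predK kT) ifT ?eqxx ?mulr1.
move=> [T1 j]; rewrite xpair_eqE /G /= eqSS (eq_sym T) (eq_sym _ j).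
by case: ifP => _; rewrite ?mulr0 // => /negbTE ->; rewrite mulr0.
Qed.

Lemma off_axisC v u : off_axis (v, u) = off_axis (u, v).
Proof. by rewrite /off_axis /= ![v.1 == _]eq_sym ![v.2 == _]eq_sym. Qed.

Lemma big_journeys (R : Type) (idx : R) (op : Monoid.law idx) N
    (F : Defs.point * Defs.point -> R) :
  \big[op/idx]_(p <- journeys N) F p =
  \big[op/idx]_(v <- grid N) \big[op/idx]_(u <- grid N)
    if v != u then F (v, u) else idx.
Proof. by rewrite big_filter big_mkcond /= big_allpairs_dep. Qed.

(** Exchanging the endpoints of a journey preserves its number of paths, because [off_axis] is
    symmetric. *)
Lemma sum_traces_endpoint N u :
  (\sum_(T <- traces N) (tr_end T == u) = \sum_(T <- traces N) (tr_start T == u))%N.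
Proof.
rewrite !big_traces !big_journeys exchange_big /=.
apply: eq_bigr => v _; apply: eq_bigr => w _.
by rewrite off_axisC eq_sym hv_path_end hv_path_start vh_path_start vh_path_end.
Qed.

Lemma size_traces_to N u :
  size [seq T <- traces N | tr_end T == u] = size (traces_from N u).
Proof.
rewrite !size_filter -!sum1_count big_mkcond [RHS]big_mkcond.
exact: sum_traces_endpoint.
Qed.

(* A stationary p takes one value along a trace, and that value depends only on
   the starting point of the trace: it is the mean of the values of the traces
   that end there.  Every grid point has a trace to any other, so the maximum
   of p propagates to all traces. *)
Lemma stationary_const (R : realType) N (p : {ffun state N -> R}) :
  stationary p -> forall s t, p s = p t.
Proof.
case=> _ _ p_stat.
suff [M pM] : exists M, forall s, p s = M by move=> s t; rewrite !pM.
case: (pselect (exists s : state N, True)) => [[s0 _]|no]; last first.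
  by exists 0 => s; case: no; exists s.
case: (@arg_maxP _ _ _ s0 xpredT p) => // sM _ sM_max; exists (p sM) => s.
(* Extending [p] by 0 to all pairs avoids carrying membership proofs. *)
pose P x := if insub x is Some s then p s else 0.
have PE (t : state N) : P (val t) = p t by rewrite /P valK.
have P_le x : x \in states N -> P x <= p sM.
  by move=> xN; have -> : P x = p (SeqSub xN) := PE (SeqSub xN); exact: sM_max.
have P_stat (t : state N) : \sum_s P (val s) * trans R s t = P (val t).
  by rewrite PE -p_stat; apply: eq_bigr => s' _; rewrite PE.
have PT T k : T \in traces N -> (0 < k < size T)%N -> P (T, k) = P (T, 1%N).
  move=> TN; elim: k => // -[//|k] IH kT.
  have TkN : (T, k.+2) \in states N by rewrite mem_states TN kT.
  by rewrite -(P_stat (SeqSub TkN)) (@sum_trans_next _ _ _ _ k) // IH //; lia.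
pose K u : R := (size (traces_from N u))%:R.
have P1 T : T \in traces N ->
    P (T, 1%N) = (\sum_(T' <- traces N | tr_end T' == tr_start T) P (T', 1%N)) /
      K (tr_start T).
  move=> TN; have T1N : (T, 1%N) \in states N by rewrite mem_states TN (size_trace TN).
  rewrite -(P_stat (SeqSub T1N)) sum_trans_first //=; congr (_ / _).
  rewrite big_seq_cond [RHS]big_seq_cond; apply: eq_bigr => T' /andP[T'N _].
  by rewrite PT // -ltnS (ltn_predK (size_trace T'N)) (size_trace T'N) /=.
have P1_start T T' : T \in traces N -> T' \in traces N -> tr_start T = tr_start T' ->
  P (T, 1%N) = P (T', 1%N) by move=> TN T'N e; rewrite P1 // e -P1.
have P1_max T T' : T \in traces N -> P (T, 1%N) = p sM -> T' \in traces N ->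
    tr_end T' = tr_start T -> P (T', 1%N) = p sM.
  move=> TN PM T'N T'T.
  have K0 : K (tr_start T) != 0.
    rewrite pnatr_eq0 -lt0n size_filter -has_count; by apply/hasP; exists T.
  (* The mean of the values [P (T1, 1)] equals their upper bound, so the nonnegative gaps sum to 0
     and each of them vanishes. *)
  have : \sum_(T1 <- traces N | tr_end T1 == tr_start T) (p sM - P (T1, 1%N)) == 0.
    rewrite sumrB subr_eq0 -[X in _ == X](divfK K0) -P1 // PM.
    by rewrite big_const_seq iter_addr_0 -size_filter size_traces_to mulr_natr.
  rewrite big_seq_cond psumr_eq0 => [/allP /(_ T' T'N)|T1 /andP[T1N _]].
    by rewrite T'T eqxx T'N subr_eq0 eq_sym => /eqP.
  by rewrite subr_ge0 P_le // mem_states T1N (size_trace T1N).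
have sN x : x \in states N -> exists2 T, T \in traces N & P x = P (T, 1%N).
  by case: x => T k; rewrite mem_states => /andP[TN kT]; exists T; rewrite // PT.
have [TM TMN PTM] := sN _ (valP sM).
have [T TN PT1] := sN _ (valP s).
rewrite -PE PT1; move: PTM; rewrite PE => /esym PTM.
have [e|ne] := eqVneq (tr_start T) (tr_start TM); first by rewrite (P1_start _ TM).
have := traces_journey TN; have := traces_journey TMN.
rewrite !mem_journeys => /and3P[_ uN _] /and3P[_ vN _].
(* This trace links the two: it ends where [TM] starts, so it attains the maximum, and it starts
   where [T] starts, so it has the value of [T]. *)
have vuN : hv_path (tr_start T) (tr_start TM) \in traces N.
  by rewrite hv_path_traces // mem_journeys ne vN.
rewrite (P1_start _ _ TN vuN) ?hv_path_start //.
by apply: (P1_max TM) => //; rewrite hv_path_end.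
Qed.

(** The inflow into [<T, 1>] is the number of traces ending at the start of [T] divided by the
    number starting there, which is 1. *)
Lemma uniform_stationary (R : realType) N : (1 < N)%N ->
  stationary [ffun=> (size (states N))%:R^-1 : R] (N := N).
Proof.
move=> N1; set c := _^-1.
have sum_c F : \sum_(s : state N) ([ffun=> c] : {ffun state N -> R}) s * F s =
               c * \sum_(s : state N) F s.
  by rewrite mulr_sumr; apply: eq_bigr => s _; rewrite ffunE.
split=> [s||t].
- by rewrite ffunE invr_ge0 ler0n.
- have -> : \sum_s ([ffun=> c] : {ffun state N -> R}) s = \sum_(s : state N) c.
    by apply: eq_bigr => s _; rewrite ffunE.
  rewrite (@big_state _ _ xpredT (fun=> c)) big_const_seq iter_addr_0 count_predT.
  rewrite -mulr_natr mulVf // pnatr_eq0 -lt0n.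
  (* For [N >= 2] the step from the origin to its neighbour is a trace, so there is at least one
     state to normalise by. *)
  suff : (hv_path (0%N, 0%N) (1%N, 0%N), 1%N) \in states N by case: (states N).
  have TN : hv_path (0%N, 0%N) (1%N, 0%N) \in traces N.
    by rewrite hv_path_traces // mem_journeys !mem_grid /=; lia.
  by rewrite mem_states TN (size_trace TN).
rewrite sum_c ffunE -[RHS]mulr1; congr (_ * _).
pose P (_ : seq Defs.point * nat) : R := 1.
rewrite (eq_bigr (fun s => P (val s) * trans R s t)); last first.
  by move=> s _; rewrite mul1r.
have := valP t; case tE : (val t) => [T i]; rewrite mem_states => /andP[TN iT].
have TE : st_trace t = T by rewrite /st_trace tE.
case: i tE iT => // -[|k] tE iT.
  rewrite sum_trans_first /st_idx ?tE // /P big_const_seq iter_addr_0 TE -size_filter.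
  rewrite size_traces_to divff // pnatr_eq0 -lt0n size_filter -has_count.
  by apply/hasP; exists T.
by rewrite (@sum_trans_next _ _ _ _ k) // /st_idx tE.
Qed.

Lemma stat_distE (R : realType) N s : (1 < N)%N ->
  stat_dist R N s = (size (states N))%:R^-1.
Proof.
move=> N1.
have p_stat : stationary (stat_dist R N).
  apply: (xgetPex [ffun=> 0]).
  by exists [ffun=> (size (states N))%:R^-1]; exact: uniform_stationary.
have [_ p1 _] := p_stat; move: p1.
rewrite (eq_bigr (fun=> stat_dist R N s)) => [|t _]; last exact: stationary_const.
rewrite (@big_state _ _ xpredT (fun=> stat_dist R N s)) big_const_seq iter_addr_0.
rewrite count_predT => cS; rewrite -mulr_natr in cS.
have S0 : (size (states N))%:R != 0 :> R.
  by move: (oner_neq0 R); rewrite -[X in X != 0]cS mulf_eq0 negb_or => /andP[].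
by apply: (mulIf S0); rewrite cS mulVf.
Qed.

(** * Counting states *)

Local Open Scope nat_scope.

Lemma behead_nth (T : eqType) (x0 : T) (s : seq T) :
  behead s = [seq nth x0 s i | i <- iota 1 (size s).-1].
Proof.
case: s => //= x s; rewrite (iotaDl 1 0) -map_comp.
by rewrite -[LHS](mkseq_nth x0); apply: eq_map.
Qed.

(** This is the number of states at [u] with destination [v]: [behead] drops index 0, which is not a
    state. *)
Definition visit_count N (u v : Defs.point) : nat :=
  \sum_(T <- traces N | tr_end T == v) count_mem u (behead T).

Lemma sum_stat_dist (R : realType) N u (P : pred (seq Defs.point)) : 1 < N ->
  (\sum_(s : state N | (st_pos s == u) && P (st_trace s)) stat_dist R N s =
   (size (states N))%:R^-1 *
     (\sum_(T <- traces N | P T) count_mem u (behead T))%:R)%R.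
Proof.
move=> N1; set c := (_^-1)%R.
rewrite (eq_bigr (fun s => (fun=> c) (val s))) => [|s _]; last exact: stat_distE.
rewrite (@big_state _ _ (fun x => (tr_at x.1 x.2 == u) && P x.1) (fun=> c)).
rewrite big_mkcond big_allpairs_dep natr_sum mulr_sumr [RHS]big_mkcond /=.
apply: eq_bigr => T _; case: (P T); last first.
  by rewrite big1 // => i _; rewrite andbF.
under eq_bigr do rewrite andbT.
rewrite -big_mkcond big_const_seq iter_addr_0 mulr_natr; congr (_ *+ _)%R.
by rewrite (behead_nth (0, 0)) count_map.
Qed.

Lemma dest_distE (R : realType) N u v : 1 < N ->
  (dest_dist R N u v =
   (visit_count N u v)%:R / (\sum_(T <- traces N) count_mem u (behead T))%:R)%R.
Proof.
move=> N1; rewrite /dest_dist /spatial_dist.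
rewrite (sum_stat_dist R u (fun T => tr_end T == v) N1).
rewrite (eq_bigl (fun s => (st_pos s == u) && xpredT (st_trace s))); last first.
  by move=> s; rewrite andbT.
rewrite (sum_stat_dist R u xpredT N1).
(* The common weight of the states cancels; it is nonzero, as otherwise the total mass would be
   0. *)
have [S0|S0] := eqVneq (size (states N))%:R^-1%R (0 : R)%R; last first.
  by rewrite invfM mulrACA mulVf // mul1r mulrC.
have : states N != [::].
  apply/negP => /eqP sN.
  have [_ + _] := uniform_stationary R N1; rewrite (eq_bigr (fun=> 0%R)).
    by rewrite big1 // => /eqP; rewrite eq_sym oner_eq0.
  by move=> s _; rewrite ffunE S0.
by rewrite -size_eq0 -(eqr_nat R) -invr_eq0 S0 eqxx.
Qed.

Lemma big_grid (R : Type) (idx : R) (op : Monoid.law idx) N (F : Defs.point -> R) :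
  \big[op/idx]_(w <- grid N) F w =
  \big[op/idx]_(0 <= a < N) \big[op/idx]_(0 <= b < N) F (a, b).
Proof. by rewrite /index_iota subn0 big_allpairs. Qed.

(* Contribution of the journey from w to v; the side conditions discard the
   second path when it coincides with the first, and all terms vanish if w = v. *)
Definition journey_count (u w v : Defs.point) : nat :=
  (u.2 == w.2) * visits w.1 v.1 u.1 + (u.1 == v.1) * visits w.2 v.2 u.2 +
  ((u.1 == w.1) && (w.1 != v.1)) * visits w.2 v.2 u.2 +
  ((u.2 == v.2) && (w.2 != v.2)) * visits w.1 v.1 u.1.

Lemma journey_countE u w v :
  (if w != v then count_mem u (behead (hv_path w v)) +
     (if off_axis (w, v) then count_mem u (behead (vh_path w v)) else 0) else 0) =
  journey_count u w v.
Proof.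
rewrite count_behead_hv_path count_behead_vh_path /journey_count /off_axis.
case: u w v => [i0 j0] [a b] [i j] /=; rewrite xpair_eqE.
have visits0 x y : visits x x y = false by rewrite /visits; lia.
have [->|_] := eqVneq a i; have [->|_] := eqVneq b j => /=;
  rewrite ?visits0 ?andbF ?andbT ?muln0 ?addn0 ?addnA //.
Qed.

Lemma visit_countE N u v : v \in grid N ->
  visit_count N u v = \sum_(w <- grid N) journey_count u w v.
Proof.
move=> vN; rewrite /visit_count big_mkcond big_traces big_journeys.
apply: eq_bigr => w _; rewrite (bigD1_seq v) ?grid_uniq //= big1 => [|v' ne].
  by rewrite hv_path_end vh_path_end eqxx addn0 journey_countE.
by rewrite hv_path_end vh_path_end (negbTE ne) !if_same.
Qed.

Lemma sum_visit_count N u :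
  \sum_(T <- traces N) count_mem u (behead T) =
  \sum_(v <- grid N) visit_count N u v.
Proof.
rewrite big_traces big_journeys exchange_big big_seq [RHS]big_seq /=.
apply: eq_bigr => v vN; rewrite visit_countE //.
by apply: eq_bigr => w _; rewrite journey_countE.
Qed.

(** * Reduction to one axis and exact counts *)

Definition sources N v u := \sum_(0 <= a < N) visits a v u.

Lemma sum_eqn N v : \sum_(0 <= a < N) (v == a) = (v < N).
Proof.
elim: N => [|N IH]; first by rewrite big_geq.
by rewrite big_nat_recr //= IH; lia.
Qed.

Lemma sum_neqn N v : v < N -> \sum_(0 <= a < N) (a != v) = N.-1.
Proof.
move=> vN.
have : \sum_(0 <= a < N) (a != v) + \sum_(0 <= a < N) (v == a) = N.
  rewrite -big_split /= -[RHS]subn0 -[RHS]muln1 -sum_nat_const_nat.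
  by apply: eq_bigr => a _; case: (eqVneq a v).
by rewrite sum_eqn vN; lia.
Qed.

(** The terms are the four legs of [journey_count]. A first leg through the agent fixes one
    coordinate of the source. A second leg leaves it free: [N] choices for a horizontal-first path,
    but [N.-1] for a vertical-first one, where the coinciding paths were discarded. *)
Lemma visit_count_sources N i0 j0 i j : i0 < N -> j0 < N -> i < N -> j < N ->
  visit_count N (i0, j0) (i, j) =
  sources N i i0 + (i0 == i) * (N * sources N j j0) + (i0 != i) * sources N j j0 +
  (j0 == j) * (N.-1 * sources N i i0).
Proof.
move=> i0N j0N iN jN; rewrite visit_countE ?mem_grid ?iN // big_grid.
rewrite /journey_count /=.
under eq_bigr do rewrite !big_split /=.
rewrite !big_split /=; congr (_ + _ + _ + _).
- apply: eq_bigr => a _; rewrite -big_distrl /= sum_eqn j0N mul1n //.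
- under eq_bigr do rewrite -big_distrr /=.
  by rewrite sum_nat_const_nat subn0 mulnCA.
- under eq_bigr do rewrite -big_distrr /=.
  rewrite -big_distrl /=; congr (_ * _).
  under eq_bigr => a do rewrite andbC -mulnb.
  rewrite (eq_bigr (fun a => (i0 == a) * (i0 != i))) => [|a _].
    by rewrite -big_distrl /= sum_eqn i0N mul1n.
  by case: (eqVneq i0 a) => [->|_]; rewrite ?muln0 ?mul0n // muln1 mul1n.
- under eq_bigr do rewrite -big_distrl /=.
  rewrite -big_distrr /= mulnA; congr (_ * _).
  under eq_bigr do rewrite -mulnb.
  by rewrite -big_distrr /= sum_neqn.
Qed.

(** Seen from [v], the start must lie strictly beyond [u]; for [v = u] any start other than [u] will
    do. *)
Lemma sourcesE N v u : u < N -> v < N -> sources N v u =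
  if v < u then N.-1 - u else if u < v then u else N.-1.
Proof.
rewrite /sources => uN vN.
(* Truncated differences and [minn] make the formula hold for every bound [m], also below [u], as
   the induction requires. *)
have H m : \sum_(0 <= a < m) visits a v u =
  if v < u then m.-1 - u else if u < v then minn m u else m - (u < m).
  elim: m => [|m IH]; first by rewrite big_geq // min0n !sub0n !if_same.
  by rewrite big_nat_recr //= IH /visits; case: (ltngtP v u) => vu; lia.
by rewrite H; case: (ltngtP v u) => vu; lia.
Qed.

Lemma sum_sources_lt N u : u < N -> \sum_(0 <= v < u) sources N v u = u * (N.-1 - u).
Proof.
move=> uN; rewrite -[X in X * _]subn0 -sum_nat_const_nat.
apply: eq_big_nat => v /andP[_ vu]; rewrite sourcesE ?vu //; lia.
Qed.

Lemma sum_sources_gt N u : u < N ->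
  \sum_(u.+1 <= v < N) sources N v u = (N.-1 - u) * u.
Proof.
move=> uN; have -> : N.-1 - u = N - u.+1 by lia.
rewrite -sum_nat_const_nat; apply: eq_big_nat => v /andP[uv vN].
by rewrite sourcesE // ltnNge (ltnW uv) uv.
Qed.

Lemma sourcesnn N u : u < N -> sources N u u = N.-1.
Proof. by move=> uN; rewrite sourcesE // ltnn. Qed.

Lemma sum_sources N u : u < N ->
  \sum_(0 <= v < N) sources N v u = 2 * (u * (N.-1 - u)) + N.-1.
Proof.
move=> uN; rewrite (big_cat_nat _ (n := u)) ?(ltnW uN) //= (big_ltn uN).
by rewrite sum_sources_lt // sum_sources_gt // sourcesnn //; lia.
Qed.

(** For each axis the total of [sources] is weighted by [N] through horizontal-first paths and by
    [N.-1] through vertical-first ones, whence the factor [(2 * N).-1]. *)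
Lemma total_visit_count N i0 j0 : i0 < N -> j0 < N ->
  \sum_(v <- grid N) visit_count N (i0, j0) v =
  (2 * N).-1 * (2 * (i0 * (N.-1 - i0) + j0 * (N.-1 - j0) + N.-1)).
Proof.
move=> i0N j0N; rewrite big_grid.
transitivity (\sum_(0 <= i < N) (N * sources N i i0 +
    N * ((i0 == i) * \sum_(0 <= j < N) sources N j j0) +
    (i0 != i) * \sum_(0 <= j < N) sources N j j0 + N.-1 * sources N i i0)).
  apply: eq_big_nat => i /= iN.
  under eq_big_nat => j /= jN do rewrite visit_count_sources //.
  rewrite !big_split /= sum_nat_const_nat subn0; congr (_ + _ + _ + _).
  - rewrite -big_distrr /= -big_distrr /=; lia.
  - by rewrite -big_distrr.
  - by rewrite -big_distrl /= sum_eqn j0N mul1n.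
rewrite !big_split /= -!big_distrr /= -!big_distrl /= sum_eqn i0N.
under [X in _ + X * _ + _]eq_bigr do rewrite eq_sym.
rewrite sum_neqn // !sum_sources // mul1n.
have -> : (2 * N).-1 = N + N.-1 by lia.
by move: N.-1 (i0 * _) (j0 * _) => n a b; ring.
Qed.

(** One formula serves both lines through the agent: [u] and [v] are the coordinates of agent and
    destination along the line. The last term counts the vertical-first off-axis traces that end at
    the agent. *)
Definition axis_count N u v :=
  N.-1 + N * sources N v u + (u == v) * (N.-1 * N.-1).

Lemma visit_count_column N i0 j0 j : i0 < N -> j0 < N -> j < N ->
  visit_count N (i0, j0) (i0, j) = axis_count N j0 j.
Proof.
move=> i0N j0N jN.
by rewrite visit_count_sources // eqxx sourcesnn // mul1n mul0n addn0.
Qed.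

Lemma visit_count_row N i0 j0 i : i0 < N -> j0 < N -> i < N ->
  visit_count N (i0, j0) (i, j0) = axis_count N i0 i.
Proof.
move=> i0N j0N iN; rewrite visit_count_sources // eqxx sourcesnn // /axis_count.
have [<-|_] /= := eqVneq i0 i; rewrite ?sourcesnn // !mul0n !mul1n !addn0.
  by [].
(* Here the factor [N] is split: one source row from the first legs of horizontal-first paths,
   [N.-1] rows from the second legs of vertical-first paths. *)
have -> : N * sources N i i0 = sources N i i0 + N.-1 * sources N i i0.
  by rewrite -mulSn prednK // (leq_ltn_trans _ iN).
by rewrite addnAC [_ + N.-1]addnC addnA.
Qed.

(** Both closed half-axes contain the agent. Their sums differ only in the number of points
    multiplying [N.-1], a term of order [N ^ 2] that is lost in the limit; this is why opposite
    directions have equal limits. *)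
Lemma sum_axis_count_le N u : u < N ->
  \sum_(0 <= v < u.+1) axis_count N u v =
  u.+1 * N.-1 + N * (u * (N.-1 - u) + N.-1) + N.-1 * N.-1.
Proof.
move=> uN; rewrite !big_split /= -big_distrr -big_distrl /= sum_eqn ltnSn mul1n.
by rewrite sum_nat_const_nat subn0 big_nat_recr //= sum_sources_lt // sourcesnn.
Qed.

Lemma sum_axis_count_ge N u : u < N ->
  \sum_(u <= v < N) axis_count N u v =
  (N - u) * N.-1 + N * (u * (N.-1 - u) + N.-1) + N.-1 * N.-1.
Proof.
move=> uN; rewrite !big_split /= -big_distrr -big_distrl /= sum_nat_const_nat.
rewrite big_ltn // sourcesnn // sum_sources_gt // [\sum_(u <= i < N) _]big_ltn //.
rewrite eqxx big_nat big1 => [|v /andP[uv _]]; last by rewrite ltn_eqF.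
by rewrite addn0 mul1n; congr (_ + _ * _ + _); lia.
Qed.

(** * Scaling limit *)

Local Open Scope classical_set_scope.
Local Open Scope ring_scope.

(* The share of destinations on one half-axis: h is the reciprocal of N, e and
   e' are the two coordinates of the agent divided by N, k is the number of grid
   points on the half-axis divided by N, and the common factor N ^ 3 of both
   counts is cancelled. *)
Definition axis_share (R : realType) (h k e e' : R) : R :=
  (k * (1 - h) * h + e * (1 - h - e) + (1 - h) * h + h * (1 - h) ^+ 2) /
  ((2 - h) * (2 * (e * (1 - h - e) + e' * (1 - h - e') + (1 - h) * h))).

Lemma axis_shareE (R : realType) (N k u u' : nat) :
    (1 < N)%N -> (u < N)%N -> (u' < N)%N ->
  ((k * N.-1 + N * (u * (N.-1 - u) + N.-1) + N.-1 * N.-1)%N%:R /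
   ((2 * N).-1 * (2 * (u * (N.-1 - u) + u' * (N.-1 - u') + N.-1)))%N%:R : R) =
  axis_share N%:R^-1 (k%:R / N%:R) (u%:R / N%:R) (u'%:R / N%:R).
Proof.
(* With [N = n.+1] the predecessor is [n], and [u <= n] turns truncated differences into real
   ones. *)
case: N => [//|n]; rewrite ltnS => n0 un u'n.
have -> : (2 * n.+1).-1 = (n.+1 + n)%N by lia.
rewrite /axis_share /= !(natrD, natrM) !natrB // -[n.+1%:R]natr1.
have N0 : (n%:R + 1 : R) != 0 by rewrite natr1 pnatr_eq0.
have nR : 0 < n%:R :> R by rewrite ltr0n.
have uR : 0 <= u%:R * (n%:R - u%:R) :> R.
  by rewrite mulr_ge0 ?subr_ge0 ?ler_nat.
have u'R : 0 <= u'%:R * (n%:R - u'%:R) :> R.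
  by rewrite mulr_ge0 ?subr_ge0 ?ler_nat.
move: (n%:R : R) (u%:R : R) (u'%:R : R) (k%:R : R) N0 nR uR u'R => m x y z N0 m0 xm ym.
have den0 : x * (m - x) + y * (m - y) + m != 0 by rewrite gt_eqF //; lra.
have m21 : m + 1 + m != 0 by rewrite gt_eqF //; lra.
have -> : (z / (m + 1) * (1 - (m + 1)^-1) / (m + 1) +
      x / (m + 1) * (1 - (m + 1)^-1 - x / (m + 1)) + (1 - (m + 1)^-1) / (m + 1) +
      (m + 1)^-1 * (1 - (m + 1)^-1) ^+ 2) =
    (z * m + (m + 1) * (x * (m - x) + m) + m * m) * (m + 1) ^- 3 by field.
have -> : (2 - (m + 1)^-1) * (2 * (x / (m + 1) * (1 - (m + 1)^-1 - x / (m + 1)) +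
      y / (m + 1) * (1 - (m + 1)^-1 - y / (m + 1)) + (1 - (m + 1)^-1) / (m + 1))) =
    ((m + 1 + m) * (2 * (x * (m - x) + y * (m - y) + m))) * (m + 1) ^- 3 by field.
by rewrite -mulf_div divff ?mulr1 // invr_eq0 expf_neq0.
Qed.

(** At [h = 0] the term containing [k] vanishes, so the limit [l] of [k] only has to exist. The
    denominator stays nonzero because [a] and [b] lie strictly between 0 and 1. *)
Lemma cvg_axis_share (R : realType) (T : Type) (F : set_system T) {FF : Filter F}
    (h k e e' : T -> R) (l a b : R) :
    0 < a < 1 -> 0 < b < 1 ->
    h x @[x --> F] --> 0 -> k x @[x --> F] --> l ->
    e x @[x --> F] --> a -> e' x @[x --> F] --> b ->
  axis_share (h x) (k x) (e x) (e' x) @[x --> F] -->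
    a * (1 - a) / (4 * (a * (1 - a) + b * (1 - b))).
Proof.
move=> a01 b01 h0 kl ea e'b.
have ab : 0 < a * (1 - a) + b * (1 - b) by nra.
have -> : a * (1 - a) / (4 * (a * (1 - a) + b * (1 - b))) = axis_share 0 l a b.
  by rewrite /axis_share; congr (_ / _); ring.
have c1 : cst 1 x @[x --> F] --> (1 : R) by exact: cvg_cst.
have c2 : cst 2 x @[x --> F] --> (2 : R) by exact: cvg_cst.
have h1 : (1 - h x) @[x --> F] --> (1 - 0 : R) by exact: cvgB.
have eh : e x * (1 - h x - e x) @[x --> F] --> a * (1 - 0 - a).
  by apply: cvgM => //; apply: cvgB.
have e'h : e' x * (1 - h x - e' x) @[x --> F] --> b * (1 - 0 - b).
  by apply: cvgM => //; apply: cvgB.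
have hh : (1 - h x) * h x @[x --> F] --> (1 - 0) * (0 : R) by exact: cvgM.
apply: cvgM.
  apply: cvgD; last by apply: cvgM => //; exact: cvgM.
  by apply: cvgD => //; apply: cvgD => //; apply: cvgM => //; exact: cvgM.
apply: cvgV; first by rewrite !subr0 mulr0 addr0 !mulf_neq0 ?gt_eqF.
apply: cvgM; first exact: cvgB.
by apply: cvgM => //; apply: cvgD => //; exact: cvgD.
Qed.

Lemma sum_dest_column (R : realType) N i0 j0 m n :
    (1 < N)%N -> (i0 < N)%N -> (j0 < N)%N -> (n <= N)%N ->
  \sum_(m <= j < n) dest_dist R N (i0, j0) (i0, j) =
  (\sum_(m <= j < n) axis_count N j0 j)%N%:R /
  ((2 * N).-1 * (2 * (j0 * (N.-1 - j0) + i0 * (N.-1 - i0) + N.-1)))%N%:R.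
Proof.
move=> N1 i0N j0N nN; rewrite natr_sum mulr_suml.
apply: eq_big_nat => j /andP[_ jn]; rewrite dest_distE // sum_visit_count.
rewrite visit_count_column ?(leq_trans jn) // total_visit_count //.
by rewrite [(i0 * _ + _)%N]addnC.
Qed.

Lemma sum_dest_row (R : realType) N i0 j0 m n :
    (1 < N)%N -> (i0 < N)%N -> (j0 < N)%N -> (n <= N)%N ->
  \sum_(m <= i < n) dest_dist R N (i0, j0) (i, j0) =
  (\sum_(m <= i < n) axis_count N i0 i)%N%:R /
  ((2 * N).-1 * (2 * (i0 * (N.-1 - i0) + j0 * (N.-1 - j0) + N.-1)))%N%:R.
Proof.
move=> N1 i0N j0N nN; rewrite natr_sum mulr_suml.
apply: eq_big_nat => i /andP[_ iN]; rewrite dest_distE // sum_visit_count.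
by rewrite visit_count_row ?(leq_trans iN) // total_visit_count.
Qed.

(** * Grid size and grid indices for small mesh *)

Lemma grid_size_ge (R : realType) (L eps : R) : 0 < L -> 0 < eps ->
  L / eps <= (grid_size L eps)%:R.
Proof.
move=> L_gt0 e0; rewrite /grid_size natr_absz ger0_norm ?ceil_ge //.
by rewrite ceil_ge0 (lt_trans (ltrN10 _)) // divr_gt0.
Qed.

Lemma grid_size_gt1 (R : realType) (L eps : R) :
  0 < eps < L -> (1 < grid_size L eps)%N.
Proof.
move=> /andP[e0 eL]; rewrite -(ltr_nat R).
apply: lt_le_trans (grid_size_ge (lt_trans e0 eL) e0).
by rewrite ltr_pdivlMr // mul1r.
Qed.

Lemma grid_idx_itv (R : realType) (L eps x : R) : 0 < L -> 0 < x ->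
  (grid_idx L eps x)%:R <= (grid_size L eps)%:R * x / L < (grid_idx L eps x)%:R + 1.
Proof.
move=> L_gt0 x0; set y := _ * x / L.
have y0 : 0 <= y by rewrite divr_ge0 ?(ltW L_gt0) // mulr_ge0 ?(ltW x0).
rewrite /grid_idx -/y natr_absz ger0_norm ?floor_ge0 //.
by have := floor_itv y; rewrite intrD.
Qed.

Lemma grid_idx_lt (R : realType) (L eps x : R) : 0 < eps < L -> 0 < x < L ->
  (grid_idx L eps x < grid_size L eps)%N.
Proof.
move=> e0L /andP[x0 xL]; have L_gt0 := lt_trans x0 xL.
have /andP[+ _] := grid_idx_itv eps L_gt0 x0.
rewrite -(ltr_nat R) => /le_lt_trans; apply.
rewrite ltr_pdivrMr // ltr_pM2l // ltr0n.
by rewrite (leq_trans _ (grid_size_gt1 e0L)).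
Qed.

Lemma near_at_right0_lt (R : realType) (L : R) :
  0 < L -> \forall eps \near (0 : R)^'+, 0 < eps < L.
Proof.
move=> L_gt0; near=> eps; apply/andP; split; near: eps.
  exact: nbhs_right_gt.
exact: nbhs_right_lt.
Unshelve. all: by end_near. Qed.

(** The inverse is squeezed between 0 and [eps / L]. *)
Lemma cvg_grid_size_inv (R : realType) (L : R) :
  0 < L -> ((grid_size L eps)%:R^-1 : R) @[eps --> 0^'+] --> (0 : R).
Proof.
move=> L_gt0.
apply: (@squeeze_cvgr _ _ _ _ (cst 0) (fun eps => eps / L)); last 2 first.
- exact: cvg_cst.
- rewrite -[X in _ --> X](mul0r L^-1); apply: cvgM; last exact: cvg_cst.
  exact: cvg_within.
near=> eps; have e0L : 0 < eps < L by near: eps; exact: near_at_right0_lt.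
have /andP[e0 _] := e0L; rewrite invr_ge0 ler0n /= -invf_div lef_pV2 ?grid_size_ge //.
  by rewrite posrE ltr0n (leq_trans _ (grid_size_gt1 e0L)).
by rewrite posrE divr_gt0.
Unshelve. all: by end_near. Qed.

(** Rounding down costs less than one grid step, so the quotient is within [1 / N] of [x / L]. *)
Lemma cvg_grid_idx (R : realType) (L x : R) : 0 < L -> 0 < x ->
  ((grid_idx L eps x)%:R / (grid_size L eps)%:R : R) @[eps --> 0^'+] --> x / L.
Proof.
move=> L_gt0 x0.
apply: (@squeeze_cvgr _ _ _ _ (fun eps => x / L - (grid_size L eps)%:R^-1)
          (cst (x / L))); last 2 first.
- rewrite -[X in _ --> X](subr0 (x / L)); apply: cvgB; first exact: cvg_cst.
  exact: cvg_grid_size_inv.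
- exact: cvg_cst.
near=> eps; have e0L : 0 < eps < L by near: eps; exact: near_at_right0_lt.
have N0 : 0 < (grid_size L eps)%:R :> R.
  by rewrite ltr0n (leq_trans _ (grid_size_gt1 e0L)).
have /andP[lo hi] := grid_idx_itv eps L_gt0 x0.
rewrite ler_pdivlMr // ler_pdivrMr // mulrBl mulVf ?gt_eqF // lerBlDr.
by rewrite [x / L * _]mulrC mulrA lo (ltW hi).
Unshelve. all: by end_near. Qed.

(** This is the common form of the four limits; agreement of [f] with [axis_share] is asked only for
    [eps < L], which ensures [N >= 2]. *)
Lemma cvg_axis_share_grid (R : realType) (L : R) (f k : R -> R) (l x y : R) :
    0 < x < L -> 0 < y < L -> k eps @[eps --> 0^'+] --> l ->
    (forall eps : R, 0 < eps < L ->
      f eps = axis_share (grid_size L eps)%:R^-1 (k eps)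
                ((grid_idx L eps y)%:R / (grid_size L eps)%:R)
                ((grid_idx L eps x)%:R / (grid_size L eps)%:R)) ->
  f eps @[eps --> 0^'+] --> y * (L - y) / (4 * L * (x + y) - 4 * (x ^+ 2 + y ^+ 2)).
Proof.
move=> xL yL kl fE.
have /andP[x0 ltxL] := xL; have /andP[y0 _] := yL.
have L_gt0 := lt_trans x0 ltxL.
have scaled z : 0 < z < L -> 0 < z / L < 1.
  by move=> /andP[z0 zL]; rewrite divr_gt0 //= ltr_pdivrMr // mul1r.
have <- : y / L * (1 - y / L) / (4 * (y / L * (1 - y / L) + x / L * (1 - x / L))) =
    y * (L - y) / (4 * L * (x + y) - 4 * (x ^+ 2 + y ^+ 2)).
  have L0 : L != 0 by rewrite gt_eqF.
  have -> : y / L * (1 - y / L) = y * (L - y) * L ^- 2 by field.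
  have -> : 4 * (y * (L - y) * L ^- 2 + x / L * (1 - x / L)) =
    (4 * L * (x + y) - 4 * (x ^+ 2 + y ^+ 2)) * L ^- 2 by field.
  by rewrite -mulf_div divff ?mulr1 // invr_eq0 expf_neq0.
apply: cvg_trans; last first.
  exact: (cvg_axis_share (scaled y yL) (scaled x xL) (cvg_grid_size_inv L_gt0) kl
    (cvg_grid_idx L_gt0 y0) (cvg_grid_idx L_gt0 x0)).
apply: near_eq_cvg; near=> eps; rewrite fE //.
by near: eps; exact: near_at_right0_lt.
Unshelve. all: by end_near. Qed.

Theorem mainTheorem9 (R : realType) (L x0 y0 : R)
    (L_gt0 : 0 < L) (x0_in : 0 < x0 < L) (y0_in : 0 < y0 < L) :
  let N (eps : R) := grid_size L eps in
  let i0 (eps : R) := grid_idx L eps x0 in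
  let j0 (eps : R) := grid_idx L eps y0 in
  let d (eps : R) (i j : nat) : R :=
    dest_dist R (N eps) (i0 eps, j0 eps) (i, j) in
  let south (eps : R) := \sum_(0 <= j < (j0 eps).+1) d eps (i0 eps) j in
  let north (eps : R) := \sum_(j0 eps <= j < N eps) d eps (i0 eps) j in
  let west (eps : R) := \sum_(0 <= i < (i0 eps).+1) d eps i (j0 eps) in
  let east (eps : R) := \sum_(i0 eps <= i < N eps) d eps i (j0 eps) in
  let phi_south := lim (south eps @[eps --> 0^'+]) in
  let phi_north := lim (north eps @[eps --> 0^'+]) in
  let phi_west := lim (west eps @[eps --> 0^'+]) in
  let phi_east := lim (east eps @[eps --> 0^'+]) in
  let D := 4 * L * (x0 + y0) - 4 * (x0 ^+ 2 + y0 ^+ 2) in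
  [/\ cvg (south eps @[eps --> 0^'+]), cvg (north eps @[eps --> 0^'+]),
      cvg (west eps @[eps --> 0^'+]) & cvg (east eps @[eps --> 0^'+])] /\
  [/\ phi_south = y0 * (L - y0) / D,
      phi_north = y0 * (L - y0) / D,
      phi_west = x0 * (L - x0) / D,
      phi_east = x0 * (L - x0) / D &
      phi_south + phi_north + phi_west + phi_east = 1 / 2].
Proof.
move=> N i0 j0 d south north west east phi_south phi_north phi_west phi_east D.
have /andP[x0_gt0 x0_lt] := x0_in; have /andP[y0_gt0 y0_lt] := y0_in.
(* West and east use the limit lemma with the two coordinates exchanged. *)
have DE : 4 * L * (y0 + x0) - 4 * (y0 ^+ 2 + x0 ^+ 2) = D by rewrite /D; ring.
(* The half-axes towards south and west have [u.+1] grid points, those towards north and east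
   [N - u], where [u] is the index of the agent. *)
have succ_cvg (z : R) : 0 < z -> (grid_idx L eps z).+1%:R / (grid_size L eps)%:R
    @[eps --> 0^'+] --> z / L + 0.
  move=> z0; under eq_cvg do rewrite -natr1 mulrDl mul1r.
  by apply: cvgD; [exact: cvg_grid_idx | exact: cvg_grid_size_inv].
have sub_cvg (z : R) : 0 < z < L ->
    (grid_size L eps - grid_idx L eps z)%:R / (grid_size L eps)%:R
    @[eps --> 0^'+] --> 1 - z / L.
  move=> zL; have /andP[z0 _] := zL.
  have : (1 - (grid_idx L eps z)%:R / (grid_size L eps)%:R : R)
      @[eps --> 0^'+] --> 1 - z / L.
    by apply: cvgB; [exact: cvg_cst | exact: cvg_grid_idx].
  move=> share_cvg; apply: (cvg_trans _ share_cvg); apply: near_eq_cvg; near=> eps.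
  have e0L : 0 < eps < L by near: eps; exact: near_at_right0_lt.
  have idxN := grid_idx_lt e0L zL.
  by rewrite natrB ?(ltnW idxN) // mulrBl divff //
             pnatr_eq0 -lt0n (leq_ltn_trans _ idxN).
have south_cvg : south eps @[eps --> 0^'+] --> y0 * (L - y0) / D.
  apply: (cvg_axis_share_grid x0_in y0_in (succ_cvg _ y0_gt0)) => eps e0L.
  have [N1 i0N j0N] : [/\ (1 < N eps)%N, (i0 eps < N eps)%N & (j0 eps < N eps)%N].
    by split; [exact: grid_size_gt1 | exact: grid_idx_lt | exact: grid_idx_lt].
  by rewrite /south /d sum_dest_column // sum_axis_count_le // axis_shareE.
have north_cvg : north eps @[eps --> 0^'+] --> y0 * (L - y0) / D.
  apply: (cvg_axis_share_grid x0_in y0_in (sub_cvg _ y0_in)) => eps e0L.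
  have [N1 i0N j0N] : [/\ (1 < N eps)%N, (i0 eps < N eps)%N & (j0 eps < N eps)%N].
    by split; [exact: grid_size_gt1 | exact: grid_idx_lt | exact: grid_idx_lt].
  by rewrite /north /d sum_dest_column // sum_axis_count_ge // axis_shareE.
have west_cvg : west eps @[eps --> 0^'+] --> x0 * (L - x0) / D.
  rewrite -DE.
  apply: (cvg_axis_share_grid y0_in x0_in (succ_cvg _ x0_gt0)) => eps e0L.
  have [N1 i0N j0N] : [/\ (1 < N eps)%N, (i0 eps < N eps)%N & (j0 eps < N eps)%N].
    by split; [exact: grid_size_gt1 | exact: grid_idx_lt | exact: grid_idx_lt].
  by rewrite /west /d sum_dest_row // sum_axis_count_le // axis_shareE.
have east_cvg : east eps @[eps --> 0^'+] --> x0 * (L - x0) / D.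
  rewrite -DE.
  apply: (cvg_axis_share_grid y0_in x0_in (sub_cvg _ x0_in)) => eps e0L.
  have [N1 i0N j0N] : [/\ (1 < N eps)%N, (i0 eps < N eps)%N & (j0 eps < N eps)%N].
    by split; [exact: grid_size_gt1 | exact: grid_idx_lt | exact: grid_idx_lt].
  by rewrite /east /d sum_dest_row // sum_axis_count_ge // axis_shareE.
(* [D] equals [4 * (x0 * (L - x0) + y0 * (L - y0))], which is positive; the four numerators add up
   to half of it. *)
have D0 : D != 0.
  by rewrite gt_eqF // /D; nra.
split; first by split; apply: cvgP; eassumption.
have lims := (cvg_lim (@Rhausdorff R) south_cvg, cvg_lim (@Rhausdorff R) north_cvg,
  cvg_lim (@Rhausdorff R) west_cvg, cvg_lim (@Rhausdorff R) east_cvg).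
split; rewrite /phi_south /phi_north /phi_west /phi_east ?lims //.
by rewrite /D in D0 *; field.
Unshelve. all: by end_near. Qed.
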